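(* Let $X\subseteq\mathbb{R}$, let $f:X\to\mathbb{C}$, let $r\in\mathbb{R}$ be a cluster point of $X$, and let $L\in\mathbb{C}$. Then the following statements are equivalent: (a) $\lim_{x\to r}f(x)=L$. (b) ${}^*f(r+dx)\approx L$ for all non-zero infinitesimals $dx$ such that $r+dx\in{}^*X$. (c) ${}^*f(x)\approx L$ for all $x\in{}^*X$ such that $x\approx r$, $x\neq r$. (d) $\mathrm{st}[{}^*f(r+dx)]=L$ for all non-zero infinitesimals $dx$ such that $r+dx\in{}^*X$.
   Context: $\mathbb{R}_+$ is the set of positive real numbers and $\mathbb{N}=\{1,2,3,\dots\}$. Fix an ultrafilter $\mathcal{U}$ on $\mathbb{R}_+$ such that $(0,\tfrac1n)\in\mathcal{U}$ for all $n\in\mathbb{N}$. A property of $\varepsilon\in\mathbb{R}_+$ holds almost everywhere (a.e.) if the set of $\varepsilon$ for which it holds belongs to $\mathcal{U}$. For nets $(a_\varepsilon),(b_\varepsilon)\in\mathbb{C}^{\mathbb{R}_+}$ write $(a_\varepsilon)\sim(b_\varepsilon)$ if $a_\varepsilon=b_\varepsilon$ a.e.; $\langle a_\varepsilon\rangle$ is the equivalence class, and ${}^*\mathbb{C}=\mathbb{C}^{\mathbb{R}_+}/\!\sim$ with operations induced pointwise; $\mathbb{C}$ is embedded via constant nets; $|\langle z_\varepsilon\rangle|=\langle|z_\varepsilon|\rangle$. For $S\subseteq\mathbb{C}$, ${}^*S=\{\langle s_\varepsilon\rangle : s_\varepsilon\in S\text{ a.e.}\}$; in particular this defines ${}^*\mathbb{R}$,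 ordered by $\langle a_\varepsilon\rangle<\langle b_\varepsilon\rangle$ iff $a_\varepsilon<b_\varepsilon$ a.e. For $f:X\to\mathbb{C}$, ${}^*f:{}^*X\to{}^*\mathbb{C}$ is ${}^*f(\langle x_\varepsilon\rangle)=\langle f(x_\varepsilon)\rangle$, where the representative is chosen with $x_\varepsilon\in X$ for all $\varepsilon$. $z\in{}^*\mathbb{C}$ is infinitesimal if $|z|<\tfrac1n$ for all $n\in\mathbb{N}$, and finite if $|z|\le n$ for some $n\in\mathbb{N}$; $a\approx b$ means $a-b$ is infinitesimal. Here $dx$ ranges over infinitesimals of ${}^*\mathbb{R}$. For finite $x\in{}^*\mathbb{R}$, $\mathrm{st}(x)=\sup\{t\in\mathbb{R}:t\le x\}$, and for finite $x+iy$ with $x,y\in{}^*\mathbb{R}$, $\mathrm{st}(x+iy)=\mathrm{st}(x)+i\,\mathrm{st}(y)$; an equality $\mathrm{st}(w)=L$ with $L\in\mathbb{C}$ is understood to include that $w$ is finite. A cluster point of $X$ is a point $r$ such that $\{x\in X:0<|x-r|<\delta\}\ne\varnothing$ for every $\delta\in\mathbb{R}_+$. $\lim_{x\to r}f(x)=L$ is the usual punctured limit: for each $\varepsilon>0$ there is $\delta>0$ such that for all $x\in X$, $0<|x-r|<\delta$ implies $|f(x)-L|<\varepsilon$. *)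

(* Defs.v *)
(* The real field is an arbitrary realType R, and the complex field is R[i]. *)
From HB Require Import structures.
From mathcomp Require Import all_boot all_order all_algebra.
From mathcomp Require Import complex interval_inference.
From mathcomp Require Import all_classical all_reals.

Set Implicit Arguments.
Unset Strict Implicit.
Unset Printing Implicit Defensive.

Import Order.TTheory GRing.Theory Num.Theory.
Local Open Scope classical_set_scope.
Local Open Scope complex_scope.
Local Open Scope ring_scope.
Local Open Scope quotient_scope.

Section Hypercomplex.
Variables (R : realType) (U : set_system {posnum R}).
Context {FU : UltraFilter U}.

Definition net : Type := {posnum R} -> R[i].
HB.instance Definition _ := Choice.on net.

(* U is an arbitrary ultrafilter here: the condition that the intervals (0, 1/n)
   belong to it is left to the statements that need it. *)
Definition ae_eq (a b : net) : bool := `[< \forall e \near U, a e = b e >].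

Lemma ae_eqP (a b : net) : reflect (\forall e \near U, a e = b e) (ae_eq a b).
Proof. exact: asboolP. Qed.

Lemma ae_eq_refl : reflexive ae_eq.
Proof. by move=> a; apply/ae_eqP; apply: filterE. Qed.

Lemma ae_eq_sym : symmetric ae_eq.
Proof.
by move=> a b; apply/ae_eqP/ae_eqP; apply: filterS => e ->.
Qed.

Lemma ae_eq_trans : transitive ae_eq.
Proof.
move=> b a c /ae_eqP ab /ae_eqP bc; apply/ae_eqP.
by apply: filterS2 ab bc => e -> ->.
Qed.

Canonical ae_eq_equiv := EquivRel ae_eq ae_eq_refl ae_eq_sym ae_eq_trans.

Definition hyperC : Type := {eq_quot ae_eq}.
HB.instance Definition _ := Choice.on hyperC.
HB.instance Definition _ := EqQuotient.on hyperC.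

Definition hclass (a : net) : hyperC := \pi_hyperC a.

Lemma hclassP (a b : net) :
  hclass a = hclass b <-> \forall e \near U, a e = b e.
Proof.
split=> [/eqP|ab]; first by rewrite piE => /ae_eqP.
by apply/eqP; rewrite piE; apply/ae_eqP.
Qed.

Lemma reprP (a : net) : \forall e \near U, repr (hclass a) e = a e.
Proof. by apply/hclassP; rewrite /hclass reprK. Qed.

Lemma hclass_repr (x : hyperC) : hclass (repr x) = x.
Proof. exact: reprK. Qed.

Definition hconst (z : R[i]) : hyperC := hclass (fun=> z).

Definition hlift1 (g : R[i] -> R[i]) (x : hyperC) : hyperC :=
  hclass (fun e => g (repr x e)).
Definition hlift2 (g : R[i] -> R[i] -> R[i]) (x y : hyperC) : hyperC :=
  hclass (fun e => g (repr x e) (repr y e)).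
Definition hrel (g : rel R[i]) (x y : hyperC) : Prop :=
  \forall e \near U, g (repr x e) (repr y e).

Lemma hlift1E g a : hlift1 g (hclass a) = hclass (fun e => g (a e)).
Proof. by apply/hclassP; apply: filterS (reprP a) => e ->. Qed.

Lemma hlift2E g a b :
  hlift2 g (hclass a) (hclass b) = hclass (fun e => g (a e) (b e)).
Proof.
by apply/hclassP; apply: filterS2 (reprP a) (reprP b) => e -> ->.
Qed.

Lemma hrelE (g : rel R[i]) a b :
  hrel g (hclass a) (hclass b) <-> \forall e \near U, g (a e) (b e).
Proof.
by split; apply: filterS3 (reprP a) (reprP b) => e -> ->.
Qed.

Let hadd := hlift2 +%R.
Let hopp := hlift1 -%R.
Let hmul := hlift2 *%R.

Fact haddA : associative hadd.
Proof.
move=> x y z; rewrite -(hclass_repr x) -(hclass_repr y) -(hclass_repr z).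
by rewrite /hadd !hlift2E; congr hclass; apply/funext => e; rewrite addrA.
Qed.
Fact haddC : commutative hadd.
Proof. by move=> x y; congr hclass; apply/funext => e; rewrite addrC. Qed.
Fact hadd0 : left_id (hconst 0) hadd.
Proof.
move=> x; rewrite -(hclass_repr x) /hadd hlift2E.
by congr hclass; apply/funext => e; rewrite add0r.
Qed.
Fact haddN : left_inverse (hconst 0) hopp hadd.
Proof.
move=> x; rewrite -(hclass_repr x) /hadd /hopp hlift1E hlift2E.
by congr hclass; apply/funext => e; rewrite addNr.
Qed.
HB.instance Definition _ :=
  GRing.isZmodule.Build hyperC haddA haddC hadd0 haddN.

Fact hmulA : associative hmul.
Proof.
move=> x y z; rewrite -(hclass_repr x) -(hclass_repr y) -(hclass_repr z).
by rewrite /hmul !hlift2E; congr hclass; apply/funext => e; rewrite mulrA.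
Qed.
Fact hmulC : commutative hmul.
Proof. by move=> x y; congr hclass; apply/funext => e; rewrite mulrC. Qed.
Fact hmul1 : left_id (hconst 1) hmul.
Proof.
move=> x; rewrite -(hclass_repr x) /hmul hlift2E.
by congr hclass; apply/funext => e; rewrite mul1r.
Qed.
Fact hmulD : left_distributive hmul +%R.
Proof.
move=> x y z; rewrite -(hclass_repr x) -(hclass_repr y) -(hclass_repr z).
rewrite /hmul /GRing.add /= /hadd !hlift2E.
by congr hclass; apply/funext => e; rewrite mulrDl.
Qed.
Fact hone_neq0 : hconst 1 != 0.
Proof.
apply/eqP => /hclassP H; have [e /eqP] := filter_ex H.
by rewrite oner_eq0.
Qed.
HB.instance Definition _ :=
  GRing.Zmodule_isComNzRing.Build hyperC hmulA hmulC hmul1 hmulD hone_neq0.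

Lemma haddE a b : hclass a + hclass b = hclass (fun e => a e + b e).
Proof. exact: hlift2E. Qed.
Lemma hoppE a : - hclass a = hclass (fun e => - a e).
Proof. exact: hlift1E. Qed.
Lemma hmulE a b : hclass a * hclass b = hclass (fun e => a e * b e).
Proof. exact: hlift2E. Qed.

(* The norm of R[i] takes its values in R[i], as a nonnegative real. *)
Definition habs : hyperC -> hyperC := hlift1 (fun z => `|z|).
Definition hRe : hyperC -> hyperC := hlift1 (fun z => (complex.Re z)%:C).
Definition hIm : hyperC -> hyperC := hlift1 (fun z => (complex.Im z)%:C).

Lemma hReIm x : x = hRe x + hconst 'i * hIm x.
Proof.
rewrite -(hclass_repr x) /hRe /hIm !hlift1E /hconst hmulE haddE.
by congr hclass; apply/funext => e; rewrite -complexE.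
Qed.

(* The order of R[i] (equal imaginary parts and ordered real parts) restricts
   to the usual order on the reals, so that its lift to *C restricts to the
   order of *R. *)
Definition hle : hyperC -> hyperC -> Prop := hrel <=%R.
Definition hlt : hyperC -> hyperC -> Prop := hrel <%R.

Definition infinitesimal (z : hyperC) : Prop :=
  forall n : nat, (0 < n)%N -> hlt (habs z) (hconst n%:R^-1).

Definition finite (z : hyperC) : Prop :=
  exists2 n : nat, (0 < n)%N & hle (habs z) (hconst n%:R).

Definition approx (a b : hyperC) : Prop := infinitesimal (a - b).

Definition starC (S : set R[i]) : set hyperC :=
  [set hclass s | s in [set s : net | \forall e \near U, S (s e)]].

(* *X for X a set of reals, seen as a subset of C. *)
Definition star (X : set R) : set hyperC := starC [set x%:C | x in X].

Definition hyperreal : set hyperC := star setT.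

(* Meant for finite elements of *R; the supremum is taken in R. *)
Definition st_real (x : hyperC) : R := sup [set t : R | hle (hconst t%:C) x].

Definition st (z : hyperC) : R[i] := st_real (hRe z) +i* st_real (hIm z).

Lemma star_rep (X : set R) (x : star X) :
  exists s : {posnum R} -> X, val x = hclass (fun e => (val (s e))%:C).
Proof.
have [s Xs sx] := set_valP x.
have [e0 [x0 Xx0 _]] := filter_ex Xs.
have /choice[t tP] e : exists y : X,
    [set z%:C | z in X] (s e) -> s e = (val y)%:C.
  have [[y Xy ys]|nX] := pselect ([set z%:C | z in X] (s e)).
    by exists (SigSub (mem_set Xy)).
  by exists (SigSub (mem_set Xx0)).
exists t; rewrite -[LHS]sx; apply/hclassP.
by apply: filterS Xs => e /tP.
Qed.

(* The extension *f : *X -> *C, through a representative with all its values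
   in X; star_funE shows that the choice is irrelevant. *)
Definition star_fun (X : set R) (f : X -> R[i]) (x : star X) : hyperC :=
  hclass (f \o sval (cid (star_rep x))).

Lemma star_funE (X : set R) (f : X -> R[i]) (x : star X)
    (s : {posnum R} -> X) :
  val x = hclass (fun e => (val (s e))%:C) -> star_fun f x = hclass (f \o s).
Proof.
rewrite /star_fun; case: cid => t /= -> /hclassP ts; apply/hclassP.
by apply: filterS ts => e /= /complexI/val_inj ->.
Qed.

End Hypercomplex.

Arguments hyperC {R} U {FU}.
Arguments hclass {R} U {FU} a.
Arguments hconst {R} U {FU} z.
Arguments starC {R} U {FU} S.
Arguments star {R} U {FU} X.
Arguments hyperreal {R} U {FU}.

Section Reals.
Variable R : realType.

Definition cluster_point (X : set R) (r : R) : Prop :=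
  forall d : R, 0 < d -> [set x | X x /\ 0 < `|x - r| < d] !=set0.

Definition punctured_lim (X : set R) (f : X -> R[i]) (r : R) (L : R[i]) : Prop :=
  forall e : R, 0 < e -> exists2 d : R, 0 < d &
    forall x : X, 0 < `|val x - r| < d -> `|f x - L| < e%:C.

End Reals.

(* Main.v *)
Require Import Defs.
From mathcomp Require Import all_boot all_order all_algebra.
From mathcomp Require Import complex interval_inference.
From mathcomp Require Import all_classical all_reals.
Import Order.TTheory GRing.Theory Num.Theory.
Local Open Scope classical_set_scope.
Local Open Scope complex_scope.
Local Open Scope ring_scope.

(** For the class of a net, being infinitely close to a constant means that the net converges to
    that constant along [U] ([approxP]). A limit therefore transfers to every net in [X] that tends
    to [r] along [U] and is a.e. different from [r] ([punctured_lim_approx]). Conversely, if the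
    limit fails, a net of bad points contradicts (b) ([approx_punctured_lim]). Statements (b) and
    (c) differ by the translation [x = r + dx]. Statement (d) rephrases (b), because a finite number
    is infinitely close to its standard part and to no other constant ([approx_finite_st]). *)

(** After squaring, the two sides differ by the cross term, which is nonnegative. *)
Lemma ler_normc_ReIm {R : rcfType} (z : R[i]) :
  `|z| <= (`|complex.Re z| + `|complex.Im z|)%:C.
Proof.
rewrite normc_def lecR -[leRHS]ger0_norm ?addr_ge0//.
rewrite -[leRHS]sqrtr_sqr ler_wsqrtr// sqrrD !real_normK ?num_real//.
by rewrite addrAC lerDl mulrn_wge0// mulr_ge0.
Qed.

Lemma normc_real {R : rcfType} (x : R) : `|x%:C| = `|x|%:C.
Proof. by rewrite normc_def /= expr0n /= addr0 sqrtr_sqr. Qed.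

Lemma normc_ge_Im {R : rcfType} (z : R[i]) : `|complex.Im z|%:C <= `|z|.
Proof.
by rewrite normc_def lecR -sqrtr_sqr ler_wsqrtr// lerDr sqr_ge0.
Qed.

Section Approx.
Context {R : realType} {U : set_system {posnum R}} {FU : UltraFilter U}.
Implicit Types (a : net R) (z : hyperC U) (L : R[i]).

(** By the Archimedean property, the bounds 1/n can be traded for arbitrary positive reals. *)
Lemma infinitesimalP a : infinitesimal (hclass U a) <->
  forall d : R, 0 < d -> \forall e \near U, `|a e| < d%:C.
Proof.
split=> [ia d d0|ia]; last first.
  move=> n n0; rewrite /hlt /habs hlift1E; apply/hrelE.
  have := ia n%:R^-1; rewrite invr_gt0 ltr0n => /(_ n0).
  by rewrite fmorphV rmorph_nat.
have [n dn] := ltr_add_invr d0; rewrite add0r in dn.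
have := ia n.+1 isT; rewrite /hlt /habs hlift1E => /hrelE.
apply: filterS => e /lt_trans; apply.
by rewrite -[_.+1%:R](rmorph_nat (real_complex R)) -fmorphV ltcR.
Qed.

Lemma approxP a L : approx (hclass U a) (hconst U L) <->
  forall d : R, 0 < d -> \forall e \near U, `|a e - L| < d%:C.
Proof. by rewrite /approx hoppE haddE; exact: infinitesimalP. Qed.

Lemma finiteP a : finite (hclass U a) <->
  exists M : R, \forall e \near U, `|a e| <= M%:C.
Proof.
rewrite /finite /hle /habs hlift1E; split=> [[n _ /hrelE an]|[M aM]].
  by exists n%:R; rewrite rmorph_nat.
(* The successor makes the bound positive, as [finite] demands. *)
exists (Num.bound `|M|).+1 => //; apply/hrelE; apply: filterS aM => e /le_trans; apply.
rewrite -[_%:R](rmorph_nat (real_complex R)) lecR (le_trans (ler_norm M))//.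
by rewrite (le_trans (ltW (archi_boundP (normr_ge0 M))))// ler_nat.
Qed.

Lemma approx_finite {z L} : approx z (hconst U L) -> finite z.
Proof.
rewrite -(hclass_repr z) => /approxP/(_ 1 ltr01) zL; apply/finiteP.
exists (1 + complex.Re `|L|); apply: filterS zL => e zL.
by rewrite -[repr z e](subrK L) (le_trans (ler_normD _ _))// rmorphD lerD// ltW.
Qed.

(** Two a.e. properties hold together at some index, where the triangle inequality through
    [repr z e] gives [|L - L'| < |L - L'|] if the distance is positive. *)
Lemma approx_unique {z L L'} :
  approx z (hconst U L) -> approx z (hconst U L') -> L = L'.
Proof.
rewrite -(hclass_repr z) => /approxP zL /approxP zL'.
apply/eqP; rewrite -subr_eq0 -normr_eq0 eq_le normr_ge0 andbT.
rewrite -[`|_|]RRe_real ?ger0_real// -[0]/(0%:C) lecR leNgt; apply/negP.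
set d := complex.Re _ => d0; have d20 : 0 < d / 2 by rewrite divr_gt0.
have [e [aL aL']] := filter_ex (filterI (zL _ d20) (zL' _ d20)).
suff : `|L - L'| < d%:C by rewrite RRe_real ?ger0_real// ltxx.
rewrite -[L](subrK (repr z e)) -addrA (le_lt_trans (ler_normD _ _))//.
by rewrite [d]splitr rmorphD ltrD// distrC.
Qed.

(** The standard part is the supremum of the reals lying a.e. below [u]. An element of this set
    close to the supremum bounds [u] from below; the ultrafilter dichotomy bounds it from above. *)
Lemma st_real_approx {u : {posnum R} -> R} {M : R} :
  (\forall e \near U, `|u e| <= M) -> forall d : R, 0 < d ->
  \forall e \near U, `|u e - st_real (hclass U (fun e => (u e)%:C))| < d.
Proof.
move=> uM d d0.
have -> : st_real (hclass U (fun e => (u e)%:C)) =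
    sup [set t | \forall e \near U, t <= u e].
  congr sup; apply/seteqP; split=> t; rewrite /= /hle.
    by move/hrelE; apply: filterS => e; rewrite lecR.
  by move=> tu; apply/hrelE; apply: filterS tu => e; rewrite lecR.
set S := [set _ | _]; have supS : has_sup S.
  split; first by exists (- M); apply: filterS uM => e; rewrite ler_norml => /andP[].
  exists M => t St; have [e [tu]] := filter_ex (filterI St uM).
  by rewrite ler_norml => /andP[_]; apply: le_trans.
have [t St st] := sup_adherent d0 supS.
(* If [sup S + d] were a.e. below [u], it would belong to [S] and exceed its supremum. *)
have [Sd|uS] := in_ultra_setVsetC [set e | sup S + d <= u e] FU.
  by have := ub_le_sup supS.2 Sd; rewrite gerDl leNgt d0.
apply: filterS2 St uS => e tu /= /negP; rewrite -ltNge => us.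
by rewrite ltr_distl us (lt_le_trans st).
Qed.

Lemma approx_st {z} : finite z -> approx z (hconst U (st z)).
Proof.
rewrite -(hclass_repr z) => /finiteP[M zM]; apply/approxP => d d0.
have d20 : 0 < d / 2 by rewrite divr_gt0.
have bRe : \forall e \near U, `|complex.Re (repr z e)| <= M.
  by apply: filterS zM => e; rewrite -lecR; exact/le_trans/normc_ge_Re.
have bIm : \forall e \near U, `|complex.Im (repr z e)| <= M.
  by apply: filterS zM => e; rewrite -lecR; exact/le_trans/normc_ge_Im.
have uRe := st_real_approx bRe _ d20; have uIm := st_real_approx bIm _ d20.
rewrite /st /hRe /hIm !hlift1E; apply: filterS2 uRe uIm => e uRe uIm.
apply: (le_lt_trans (ler_normc_ReIm _)); rewrite ltcR [d]splitr.
by move: uRe uIm; case: (repr z e) => x y /=; exact: ltrD.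
Qed.

Lemma approx_finite_st z L :
  approx z (hconst U L) <-> finite z /\ st z = L.
Proof.
split=> [zL|[fz <-]]; last exact: approx_st.
have fz := approx_finite zL; split=> //.
exact: approx_unique (approx_st fz) zL.
Qed.

End Approx.

Section Limit.
Context {R : realType} {U : set_system {posnum R}} {FU : UltraFilter U}.
Context {X : set R}.
Implicit Types (f : X -> R[i]) (r : R) (L : R[i]).

Lemma punctured_lim_approx {f r L} : punctured_lim f r L ->
  forall x : star U X, approx (val x) (hconst U r%:C) ->
    val x != hconst U r%:C -> approx (star_fun f x) (hconst U L).
Proof.
move=> fL x; have [s xs] := star_rep x.
rewrite (star_funE f xs) xs => /approxP sr sNr; apply/approxP => d /fL[d' d'0 fd'].
(* The hypothesis only denies a.e. equality; since [U] is an ultrafilter, this yields a.e.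
   inequality. *)
have {}sNr : \forall e \near U, val (s e) != r.
  have [sr'|//] := in_ultra_setVsetC [set e | val (s e) == r] FU.
    move/eqP: sNr; case; apply/hclassP.
    by apply: filterS sr' => e /eqP ->.
  by apply: filterS => e /negP.
apply: filterS2 sNr (sr _ d'0) => e sNr; rewrite -rmorphB normc_real ltcR => sd'.
by apply: fd'; rewrite normr_gt0 subr_eq0 sNr.
Qed.

(* If the limit fails, choosing for every [d] a point of [X] at distance less
   than [d] from [r] where [f] is far from [L] yields a net that approaches [r]
   along [U], because [U] converges to [0]. *)
Lemma approx_punctured_lim {f r L} :
  (forall n : nat, (0 < n)%N -> U [set e : {posnum R} | e%:num < n%:R^-1]) ->
  (forall dx : hyperC U, hyperreal U dx -> infinitesimal dx -> dx != 0 ->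
     forall h : hconst U r%:C + dx \in star U X,
       approx (star_fun f (SigSub h)) (hconst U L)) ->
  punctured_lim f r L.
Proof.
move=> U0 fL e e0; apply: contrapT => /forall2NP far.
have /choice[s sP] (d : {posnum R}) :
    exists x : X, 0 < `|val x - r| < d%:num /\ ~ `|f x - L| < e%:C.
  have [|/existsNP[x /not_implyP xP]] := far d%:num; last by exists x.
  by case.
pose dx := @hclass _ U FU (fun d => (val (s d) - r)%:C).
have rdx : hconst U r%:C + dx = hclass U (fun d => (val (s d))%:C).
  rewrite /hconst /dx haddE; congr hclass; apply/funext => d.
  by rewrite -rmorphD addrC subrK.
have h : hconst U r%:C + dx \in star U X.
  apply/mem_set; rewrite rdx; exists (fun d => (val (s d))%:C) => //.
  by apply: filterE => d /=; exists (val (s d)) => //; exact: set_valP.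
have dxR : hyperreal U dx.
  exists (fun d => (val (s d) - r)%:C) => //.
  by apply: filterE => d /=; exists (val (s d) - r).
(* The index is its own radius: [s c] is within [c] of [r], and [c] is a.e. smaller than any given
   positive real. *)
have dxi : infinitesimal dx.
  apply/infinitesimalP => d d0.
  have [n dn] := ltr_add_invr d0; rewrite add0r in dn.
  apply: filterS (U0 n.+1 isT) => c /= cn; rewrite normc_real ltcR.
  by have [/andP[_ /lt_trans sc] _] := sP c; apply: sc; exact: lt_trans dn.
have dxN0 : dx != 0.
  apply/eqP => /hclassP dx0; have [d /complexI sr] := filter_ex dx0.
  by have [] := sP d; rewrite sr normr0 ltxx.
have := fL _ dxR dxi dxN0 h; rewrite (star_funE f (x := SigSub h) (s := s) rdx).
(* One index where [f (s d)] is within [e] of [L] already contradicts the choice of [s]. *)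
by move/approxP => /(_ e e0) /filter_ex[d]; have [] := sP d.
Qed.

End Limit.

Theorem theorem4p1p1 (R : realType) (U : set_system {posnum R})
    (FU : UltraFilter U)
    (U0 : forall n : nat, (0 < n)%N -> U [set e : {posnum R} | e%:num < n%:R^-1])
    (X : set R) (f : X -> R[i]) (r : R) (hr : cluster_point X r) (L : R[i]) :
  [<-> punctured_lim f r L;
       forall dx : hyperC U, hyperreal U dx -> infinitesimal dx -> dx != 0 ->
         forall h : hconst U r%:C + dx \in star U X,
           approx (star_fun f (SigSub h)) (hconst U L);
       forall x : star U X, approx (val x) (hconst U r%:C) ->
         val x != hconst U r%:C -> approx (star_fun f x) (hconst U L);
       forall dx : hyperC U, hyperreal U dx -> infinitesimal dx -> dx != 0 ->
         forall h : hconst U r%:C + dx \in star U X,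
           finite (star_fun f (SigSub h)) /\ st (star_fun f (SigSub h)) = L].
Proof.
have shift (dx : hyperC U) : hconst U r%:C + dx - hconst U r%:C = dx.
  by rewrite addrC addKr.
tfae=> [/punctured_lim_approx fL dx _ dxi dxN0 h|fL x xr xNr|fL dx _ dxi dxN0 h|fL].
- by apply: fL; rewrite /= ?/approx ?shift// -subr_eq0 shift.
- have h : hconst U r%:C + (val x - hconst U r%:C) \in star U X.
    by rewrite addrC subrK; exact: valP.
  have -> : x = SigSub h by apply: val_inj; rewrite /= addrC subrK.
  apply: fL => //; last by rewrite subr_eq0.
  (* It remains that [x - r] is hyperreal, which is seen on a representative of [x] with all values
     in [X]. *)
  have [s ->] := star_rep x; rewrite /hconst hoppE haddE.
  exists (fun e => (val (s e))%:C - r%:C) => //.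
  by apply: filterE => e /=; exists (val (s e) - r); rewrite ?rmorphB.
- apply/approx_finite_st/fL; rewrite /= ?/approx ?shift//.
  by rewrite -subr_eq0 shift.
- apply: (approx_punctured_lim U0) => dx dxR dxi dxN0 h.
  exact/approx_finite_st/fL.
Qed.
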